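(* There is a constant $C>0$ such that, for all positive integers $m$ and $k$, every set of at least $Ckm$ points in the plane in general position contains either a convex bundle of size $k$ and width $m$ or a non-crossing family of size $m$.
   Context: A finite point set $P$ in the plane is in general position if no line contains three points of $P$. A set of points is in convex position if its points are vertices of a convex polygon. For a positive integer $k$, a convex bundle of size $k$ in $P$ is a $k$-tuple of pairwise disjoint non-empty subsets $C_1,\dots,C_k$ of $P$ such that for every choice of points $c_i\in C_i$ ($i\in\{1,\dots,k\}$), the points $c_1,\dots,c_k$ are in convex position; its width is $\min_i |C_i|$. A non-crossing family in $P$ is a collection of four pairwise disjoint non-empty subsets $P_1,P_2,P_3,P_4$ of $P$ such that for every choice of points $p_i\in P_i$, the point $p_4$ lies in the interior of the triangle (convex hull) spanned by $p_1,p_2,p_3$; its size is $\min_i |P_i|$. *)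

(* Defs.v *)
From HB Require Import structures.
From mathcomp Require Import all_boot all_order all_algebra finmap.
From mathcomp Require Import all_classical all_reals all_analysis.
Import Order.TTheory GRing.Theory Num.Theory.
Import numFieldNormedType.Exports.

Set Implicit Arguments.
Unset Strict Implicit.
Unset Printing Implicit Defensive.

Local Open Scope classical_set_scope.
Local Open Scope ring_scope.

Notation plane R := 'rV[R]_2.

(* A line only when v != 0. *)
Definition line (R : realType) (a v : plane R) : set (plane R) :=
  [set a + t *: v | t in [set: R]].

Definition general_position (R : realType) (P : {fset plane R}) : Prop :=
  forall a v : plane R, v != 0 ->
    ~ exists p q r : plane R,
        [/\ p \in P, q \in P & r \in P] /\ uniq [:: p; q; r] /\
        [/\ line a v p, line a v q & line a v r].

Definition convex_hull (R : realType) (S : set (plane R)) : set (plane R) :=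
  smallest (@convex_set R (plane R)) S.

(* Possibly degenerate: points and segments (and the empty set) count. *)
Definition convex_polygon (R : realType) (Q : set (plane R)) : Prop :=
  exists2 V : set (plane R), finite_set V & Q = convex_hull V.

(* The vertices of a polygon are its extreme points. *)
Definition vertices (R : realType) (Q : set (plane R)) : set (plane R) :=
  [set x | Q x /\ forall (y z : plane R) (t : R), Q y -> Q z -> 0 < t < 1 ->
     x = t *: y + (1 - t) *: z -> y = x /\ z = x].

(* Since polygons may be degenerate, one point, or two points, are in convex
   position. *)
Definition convex_position (R : realType) (S : set (plane R)) : Prop :=
  exists2 Q : set (plane R), convex_polygon Q & vertices Q = S.

Definition disjoint_subsets (R : realType) (P : {fset plane R}) (n : nat)
    (F : 'I_n -> {fset plane R}) : Prop :=
  [/\ forall i, (F i `<=` P)%fset,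
      forall i, F i != fset0
    & forall i j, i != j -> [disjoint F i & F j]%fset].

(* w = min_i |F i|; there is no such w when n = 0. *)
Definition min_card (R : realType) (n : nat) (F : 'I_n -> {fset plane R})
    (w : nat) : Prop :=
  (exists i, #|` F i| = w) /\ (forall i, (w <= #|` F i|)%N).

Definition convex_bundle (R : realType) (P : {fset plane R}) (k : nat)
    (C : 'I_k -> {fset plane R}) : Prop :=
  disjoint_subsets P C /\
  forall c : 'I_k -> plane R, (forall i, c i \in C i) ->
    convex_position (range c).

(* The four sets are indexed from 0; the numerals 0, 1, 2, 3 are elements of
   'I_4, seen as the integers mod 4. *)
Definition noncrossing_family (R : realType) (P : {fset plane R})
    (F : 'I_4 -> {fset plane R}) : Prop :=
  disjoint_subsets P F /\
  forall p : 'I_4 -> plane R, (forall i, p i \in F i) ->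
    interior (convex_hull [set p 0; p 1; p 2]) (p 3).

(* Main.v *)
(** Greedily remove disjoint [2m]-point sets, each lying in a halfplane with at
    most [30m] points of [P].  If [182k] of them are found, the average halfplane
    meets few of the other sets, so [k] of them can be selected, each of which
    keeps [m] points outside the other halfplanes; points chosen from these parts
    are exposed, hence in convex position.  Otherwise most of [P] remains, in a
    set [U] such that a halfplane with [2m] points of [U] has more than [30m]
    points of [P].  A vertical slab of [24m] points of [P] contains a set [S] of
    [6m] points of [U].  A line cutting off [2m] points of [S] and [2m] points
    left of the slab then cuts off at least [2m] points right of it.  Two such
    lines, above and below the bulk of [S], and a last line halving [S] and the
    lower left set, give four sets of size [m] for which the orientations of all
    transversal triples force the point of [S] into a triangle. *)
Require Import Defs.
From mathcomp Require Import all_boot all_order all_algebra.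
From mathcomp Require Import boolp zify ring lra.
Import Order.TTheory GRing.Theory Num.Theory.

Set Implicit Arguments.
Unset Strict Implicit.
Unset Printing Implicit Defensive.


(** * Finite combinatorics: sparse subsets, greedy selection, dense blocks *)

Lemma sum_pair_weight (T : finType) (w : T -> T -> nat) (I : {set T}) (v : T) :
  v \notin I ->
  \sum_(i in v |: I) \sum_(j in v |: I | j != i) w i j =
  \sum_(i in I) \sum_(j in I | j != i) w i j + \sum_(i in I) (w i v + w v i).
Proof.
move=> vI; rewrite big_setU1 //=.
have -> : \sum_(j in v |: I | j != v) w v j = \sum_(j in I) w v j.
  apply: eq_bigl => j; rewrite !inE; case: eqVneq => [->|] //=.
    by rewrite (negbTE vI).
  by rewrite andbT.
have -> : \sum_(i in I) \sum_(j in v |: I | j != i) w i j =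
    \sum_(i in I) (w i v + \sum_(j in I | j != i) w i j).
  apply: eq_bigr => i iI; rewrite big_mkcondr big_setU1 //= -big_mkcondr.
  by have -> : v != i by apply: contraNneq vI => ->.
rewrite !big_split /=; lia.
Qed.

(** Take [I] maximizing [m * #|I|] minus the total weight inside [I]. Removing a point does not
    help, which bounds its incoming weight by [m]; adding a point of [A] does not help, so each one
    outside [I] has weight at least [m] with [I]. Double counting the latter against [d] bounds
    [#|A|]. *)
Lemma low_weight_subset (T : finType) (w : T -> T -> nat) (A : {set T})
    (m d : nat) :
    (forall v, v \in A -> \sum_(i in A) (w i v + w v i) <= d) ->
  exists I : {set T}, [/\ I \subset A, #|A| * m <= #|I| * (m + d)
    & forall v, v \in I -> \sum_(i in I | i != v) w i v <= m].
Proof.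
move=> dA.
pose E (I : {set T}) := \sum_(i in I) \sum_(j in I | j != i) w i j.
pose W := E setT.
have EW (I : {set T}) : E I <= W.
  rewrite /W /E big_mkcond [leqRHS]big_mkcond; apply: leq_sum => i _ /=.
  rewrite inE; case: ifP => // _; rewrite big_mkcond [leqRHS]big_mkcond.
  by apply: leq_sum => j _; rewrite inE; case: (j \in I) => //=.
(* The potential [m * #|I| - E I], shifted by [W] to stay in nat. *)
pose phi (I : {set T}) := (m * #|I| + W - E I)%N.
have p0 : (set0 : {set T}) \subset A by rewrite sub0set.
case: (@arg_maxnP _ set0 (fun I : {set T} => I \subset A) phi p0) => I IA Imax.
exists I; split=> //; last first.
  move=> v vI; have := Imax (I :\ v) (subset_trans (subsetDl _ _) IA).
  rewrite /phi; have v' : v \notin I :\ v by rewrite !inE eqxx.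
  have := sum_pair_weight w v'; rewrite setD1K // -/(E I) -/(E (I :\ v)) => EI.
  have := EW I; have := EW (I :\ v); have := cardsD1 v I; rewrite vI.
  have : \sum_(i in I | i != v) w i v <= \sum_(i in I :\ v) (w i v + w v i).
    rewrite (eq_bigl (mem (I :\ v))); last first.
      by move=> i; rewrite !inE andbC.
    by apply: leq_sum => i _; rewrite leq_addr.
  lia.
have out v : v \in A :\: I -> m <= \sum_(i in I) (w i v + w v i).
  rewrite inE => /andP[vI vA]; have vIA : v |: I \subset A.
    by rewrite subUset sub1set vA.
  have := Imax _ vIA; rewrite /phi; have := sum_pair_weight w vI.
  rewrite -/(E I) -/(E _) cardsU1 vI => EI; have := EW I; have := EW (v |: I).
  lia.
have : \sum_(v in A :\: I) m <= \sum_(v in I) d.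
  apply: (@leq_trans (\sum_(v in A :\: I) \sum_(i in I) (w i v + w v i))).
    exact: leq_sum.
  rewrite exchange_big /=.
  apply: leq_sum => i iI; apply: leq_trans (dA i (subsetP IA _ iI)).
  rewrite big_mkcond [leqRHS]big_mkcond; apply: leq_sum => j _.
  by rewrite inE; case: (j \in I); case: (j \in A) => //=; lia.
rewrite !sum_nat_const => h; have := cardsID I A.
by rewrite (setIidPr IA); nia.
Qed.

(** Outgoing weights are bounded, so incoming ones are at most [q * m] on average, and at least half
    of the points have incoming weight at most twice that. There both weights together are at most
    [3 * (q * m)], whence the factor [2 * (1 + 3 * q)]. *)
Lemma sparse_subset (T : finType) (w : T -> T -> nat) (m q k : nat) :
    0 < m -> (forall i, \sum_j w i j <= q * m) -> k * (6 * q + 2) <= #|T| ->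
  exists I : {set T}, k <= #|I| /\
    forall v, v \in I -> \sum_(i in I | i != v) w i v <= m.
Proof.
move=> m0 wq kT.
pose A := [set v | \sum_i w i v <= 2 * (q * m)].
have cA : #|T| <= 2 * #|A|.
  have : \sum_(v in ~: A) (2 * (q * m)).+1 <= \sum_(v : T) q * m.
    apply: leq_trans (_ : \sum_v \sum_i w i v <= _).
      rewrite big_mkcond; apply: leq_sum => v _ /=.
      by rewrite !inE -ltnNge; case: ifP.
    by rewrite exchange_big /=; apply: leq_sum.
  rewrite !sum_nat_const -[#|xpredT|]/#|T| -(cardsC A); nia.
have [v vA|I [IA cI wI]] := @low_weight_subset _ w A m (3 * (q * m)).
  rewrite big_split /=.
  have h (F : T -> nat) : \sum_(i in A) F i <= \sum_i F i.
    by rewrite big_mkcond; apply: leq_sum => i _; case: ifP.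
  have := h (w v); have := h (w^~ v); have := wq v; move: vA.
  by rewrite inE; lia.
exists I; split=> //.
suff : (2 * #|A|) * m <= #|I| * (6 * q + 2) * m.
  rewrite leq_pmul2r // => h; have := leq_trans kT (leq_trans cA h).
  by rewrite leq_pmul2r //; lia.
nia.
Qed.

Lemma subset_of_card (T : finType) (A : {set T}) (n : nat) :
  n <= #|A| -> exists2 B : {set T}, B \subset A & #|B| = n.
Proof.
move=> nA; exists [set x in take n (enum A)].
  by apply/subsetP => x; rewrite inE => /mem_take; rewrite mem_enum.
rewrite cardsE; move/card_uniqP: (take_uniq n (enum_uniq A)) => ->.
by rewrite size_take_min -cardE; apply/minn_idPl.
Qed.

(** Induction on [K]: the complement [U] of the sets chosen so far either has [t] points in some
    admissible [H], giving one more set, or is the required remainder. *)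
Lemma disjoint_subsets_or_remainder (T : finType) (h : {set T} -> Prop)
    (t K : nat) :
  (exists H C : 'I_K -> {set T},
     [/\ forall i, h (H i), forall i, C i \subset H i, forall i, #|C i| = t
       & forall i j, i != j -> [disjoint C i & C j]]) \/
  (exists U : {set T}, #|T| <= #|U| + K * t /\
     forall H, h H -> #|U :&: H| < t).
Proof.
elim: K => [|K [[H [C [hH CH cC dC]]]|[U [cU hU]]]]; last 1 first.
- by right; exists U; split=> //; lia.
- left; exists (fun=> set0), (fun=> set0).
  by split=> [[]|[]|[]|[]].
pose U := ~: \bigcup_i C i.
have cU : #|T| <= #|U| + K.+1 * t.
  rewrite -(cardsC U) setCK leq_add2l.
  apply: (@leq_trans (\sum_i #|C i|)).
    elim/big_rec2: _ => [|i n X _ hX]; first by rewrite cards0.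
    by apply: leq_trans (leq_card_setU _ _) _; rewrite leq_add2l.
  by rewrite (eq_bigr (fun=> t)) // sum_nat_const card_ord; lia.
case: (pselect (exists H, h H /\ t <= #|U :&: H|)) => [[H0 [hH0 tH0]]|nH].
  left; have [C0 C0U cC0] : exists2 C0 : {set T}, C0 \subset U :&: H0 & #|C0| = t.
    exact: subset_of_card tH0.
  pose ext (A0 : {set T}) (A : 'I_K -> {set T}) (i : 'I_K.+1) :=
    oapp A A0 (unlift ord0 i).
  exists (ext H0 H), (ext C0 C); split=> [i|i|i|i j].
  - by rewrite /ext; case: unliftP => [i' _|_] //=.
  - rewrite /ext; case: unliftP => [i' _|_] //=.
    exact: subset_trans C0U (subsetIr _ _).
  - by rewrite /ext; case: unliftP => [i' _|_] //=.
  have dC0 l : [disjoint C0 & C l].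
    have sC0 : C0 \subset U by apply: subset_trans C0U (subsetIl _ _).
    rewrite disjoints_subset; apply: subset_trans sC0 _.
    by rewrite setCS (bigcup_sup l).
  rewrite /ext; case: unliftP => [i' ->|->]; case: unliftP => [j' ->|->] //=.
  - by rewrite (inj_eq lift_inj) => /dC.
  - by rewrite disjoint_sym.
right; exists U; split=> // H1 hH1; rewrite ltnNge; apply/negP => tH.
by apply: nH; exists H1.
Qed.

(** Blocks of [4 * q] entries are cut from the front. A block with fewer than [q] marked entries is
    below the density in the hypothesis, which thus passes to the rest; the slack [4 * q] covers a
    short last block. *)
Lemma dense_block (T : Type) (a : pred T) (q : nat) (s : seq T) :
    size s + 4 * q <= 4 * count a s ->
  exists s1 s2 s3, [/\ s = s1 ++ s2 ++ s3, size s2 <= 4 * q & q <= count a s2].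
Proof.
have [n] := ubnP (size s); elim: n s => // n IHn s sn h.
case: (posnP q) => [->|q0]; first by exists [::], [::], s.
case: (leqP q (count a (take (4 * q) s))) => [qs|qs].
  exists [::], (take (4 * q) s), (drop (4 * q) s).
  by rewrite cat_take_drop size_take_min geq_minl.
have := count_cat a (take (4 * q) s) (drop (4 * q) s).
rewrite cat_take_drop => cs.
have := size_drop (4 * q) s; have := count_size a (drop (4 * q) s) => cd sd.
have [||s1 [s2 [s3 [es s2q qc]]]] := IHn (drop (4 * q) s); [lia|lia|].
exists (take (4 * q) s ++ s1), s2, s3; split=> //.
by rewrite -catA -es cat_take_drop.
Qed.


(** * Orientations, halfplanes and halving lines *)

Local Open Scope ring_scope.

(** Twice the signed area of the triangle, positive for a counterclockwise turn. Coordinates are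
    functions on an abstract type, so that a reflection or a shear only changes [X] or [Y]. *)
Definition orient (R : realFieldType) (T : Type) (X Y : T -> R) (a b c : T) :=
  (X b - X a) * (Y c - Y a) - (Y b - Y a) * (X c - X a).

Definition halfplane (R : realFieldType) (T : finType) (X Y : T -> R)
    (u v c : R) : {set T} := [set p | c <= u * X p + v * Y p].

Lemma arg_max_in (R : realFieldType) (T : finType) (A : {set T}) (f : T -> R) :
  (0 < #|A|)%N -> exists2 a, a \in A & forall b, b \in A -> f b <= f a.
Proof.
case/card_gt0P => a0 a0A; have P0 : (fun a => a \in A) a0 by [].
by case: (arg_maxP f P0) => a aA amax; exists a.
Qed.

(* A discrete ham-sandwich cut: the slope of the line is the minimum, over
   [j]-subsets [J] of [A] and large subsets [I] of [S], of the largest slope of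
   a line joining [J] to [I]. *)
Lemma halving_line (R : realFieldType) (T : finType) (X Y : T -> R)
    (A S : {set T}) (j t : nat) :
    (forall a s, a \in A -> s \in S -> X a < X s) ->
    (0 < j <= #|A|)%N -> (0 < t <= #|S|)%N ->
  exists u c : R, let g p := Y p - u * X p in
    [/\ (#|[set p in A | (c < g p)%R]| < j)%N, (j <= #|[set p in A | (c <= g p)%R]|)%N,
        (#|[set p in S | (c < g p)%R]| < t)%N
      & (t <= #|[set p in S | (c <= g p)%R]|)%N].
Proof.
move=> AS /andP[j0 jA] /andP[t0 tS].
(* With [i] points of [S] on or below a line, at most [t - 1] are strictly above it; with fewer than
   [i] strictly below, at least [t] are on or above. *)
pose i := (#|S| - t).+1.
pose sl a s := (Y s - Y a) / (X s - X a).
pose valid (J I : {set T}) :=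
  [&& J \subset A, (j <= #|J|)%N, I \subset S & (i <= #|I|)%N].
pose good (q : ({set T} * {set T}) * (T * T)) :=
  [&& valid q.1.1 q.1.2, q.2 \in setX q.1.1 q.1.2 &
      [forall r in setX q.1.1 q.1.2, sl r.1 r.2 <= sl q.2.1 q.2.2]].
have goodP J I : valid J I -> exists r, good ((J, I), r).
  move=> vJI; have [JA jJ IS iI] := and4P vJI.
  have [|r rJI rmax] :=
      @arg_max_in _ _ (setX J I) (fun r : T * T => sl r.1 r.2).
    rewrite cardsX muln_gt0; apply/andP; split; first exact: leq_trans jJ.
    exact: leq_trans iI.
  by exists r; rewrite /good vJI rJI; apply/forall_inP.
have vAS : valid A S by rewrite /valid !subxx jA /i; lia.
have [r0 gr0] := goodP _ _ vAS.
case: (arg_minP (fun q : ({set T} * {set T}) * (T * T) => sl q.2.1 q.2.2) gr0).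
case=> [[J I] [a0 s0]] /and3P[/= vJI]; rewrite inE /= => /andP[a0J s0I].
move=> /forall_inP slmax slmin.
have [JA jJ IS iI] := and4P vJI.
pose u := sl a0 s0; pose g p := Y p - u * X p; pose c := g a0.
have min_valid J' I' : valid J' I' ->
    exists a s, [/\ a \in J', s \in I' & u <= sl a s].
  case/goodP => [[a s]] gas; have := slmin _ gas; have /and3P[_ /=] := gas.
  by rewrite inE /= => /andP[aJ sI] _ uas; exists a, s.
(* Since [A] lies to the left of [S], comparing the slope of a joining line with [u] amounts to
   comparing [g] at its two points. *)
have le_sl a s : a \in A -> s \in S -> (sl a s <= u) = (g s <= g a).
  move=> aA sS; have d0 : 0 < X s - X a by rewrite subr_gt0 AS.
  by rewrite /sl ler_pdivrMr // /g; apply/idP/idP; lra.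
have ge_sl a s : a \in A -> s \in S -> (u <= sl a s) = (g a <= g s).
  move=> aA sS; have d0 : 0 < X s - X a by rewrite subr_gt0 AS.
  by rewrite /sl ler_pdivlMr // /g; apply/idP/idP; lra.
have a0A := subsetP JA _ a0J; have s0S := subsetP IS _ s0I.
have gs0 : g s0 = c.
  by apply/eqP; rewrite eq_le /c -le_sl // -ge_sl // lexx.
have gJ a : a \in J -> c <= g a.
  move=> aJ; rewrite -gs0 -le_sl ?(subsetP JA) //.
  by apply: (slmax (a, s0)); rewrite inE /= aJ.
have gI s : s \in I -> g s <= c.
  move=> sI; rewrite -le_sl ?(subsetP IS) //.
  by apply: (slmax (a0, s)); rewrite inE /= a0J.
have jA' : (j <= #|[set p in A | (c <= g p)%R]|)%N.
  apply: leq_trans jJ (subset_leq_card _); apply/subsetP => a aJ.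
  by rewrite inE (subsetP JA) //= gJ.
have iS' : (i <= #|[set p in S | (g p <= c)%R]|)%N.
  apply: leq_trans iI (subset_leq_card _); apply/subsetP => s sI.
  by rewrite inE (subsetP IS) //= gI.
have sA (P : pred T) : [set p in A | P p] \subset A.
  by apply/subsetP => p; rewrite inE => /andP[].
have sS (P : pred T) : [set p in S | P p] \subset S.
  by apply/subsetP => p; rewrite inE => /andP[].
have cS (P Q : pred T) : (forall p, Q p = ~~ P p) ->
    (#|[set p in S | P p]| + #|[set p in S | Q p]| = #|S|)%N.
  move=> QP; rewrite -(cardsID [set p | P p] S); congr addn.
    by apply: eq_card => p; rewrite !inE andbC.
  by apply: eq_card => p; rewrite !inE QP andbC.
have compl a b : (#|S| - t < a -> a + b = #|S| -> b < t)%N by lia.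
have compl' a b : (a < (#|S| - t).+1 -> a + b = #|S| -> t <= b)%N by lia.
exists u, c => /=; split=> //.
(* Otherwise the two sets below are valid and every line joining them has slope less than [u],
   against minimality. The last bullet exchanges the strict and the weak inequality. *)
- rewrite ltnNge; apply/negP => jA2.
  have [|a [s []]] := min_valid [set p in A | (c < g p)%R] [set p in S | (g p <= c)%R].
    by rewrite /valid sA sS iS' andbT jA2.
  rewrite !inE => /andP[aA ca] /andP[sS' sc]; rewrite ge_sl // => h.
  by have := lt_le_trans ca (le_trans h sc); rewrite ltxx.
- have := cS (fun p => g p <= c) (fun p => c < g p) (fun p => ltNge _ _).
  move: iS'; rewrite /i.
  by move=> h1 h2; apply: compl h1 h2.
- have : (#|[set p in S | (g p < c)%R]| < i)%N.
    rewrite ltnNge; apply/negP => iS2.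
    have [|a [s []]] := min_valid [set p in A | (c <= g p)%R] [set p in S | (g p < c)%R].
      by rewrite /valid sA sS iS2 andbT jA'.
    rewrite !inE => /andP[aA ca] /andP[sS' sc]; rewrite ge_sl // => h.
    by have := le_lt_trans (le_trans ca h) sc; rewrite ltxx.
  have := cS (fun p => g p < c) (fun p => c <= g p) (fun p => leNgt _ _).
  by move=> h1 h2; apply: compl' h2 h1.
Qed.


(** * Signs of orientations in generic point sets *)

Definition generic (R : realFieldType) (T : eqType) (X Y : T -> R) :=
  forall a b c, uniq [:: a; b; c] -> orient X Y a b c != 0.

Lemma card_generic_line (R : realFieldType) (T : finType) (X Y : T -> R)
    (u c : R) :
  generic X Y -> (#|[set p : T | (Y p - u * X p == c)%R]| <= 2)%N.
Proof.
move=> gXY; rewrite leqNgt; apply/negP => /card_gt2P[a [b [d [[]]]]].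
rewrite !inE => /eqP ga /eqP gb /eqP gd [ab bd da].
have /gXY : uniq [:: a; b; d] by rewrite /= !inE negb_or ab bd [a == d]eq_sym da.
rewrite /orient => /eqP; apply.
have -> : Y a = c + u * X a by rewrite -ga; ring.
have -> : Y b = c + u * X b by rewrite -gb; ring.
have -> : Y d = c + u * X d by rewrite -gd; ring.
by ring.
Qed.

(** With b', c', r' the vectors from [s], the identity is the first coordinate of det(c', r') b' +
    det(r', b') c' + det(b', c') r' = 0. As [b] is left of [s] and [c], [r] are right of it, two
    positive determinants force the third. *)
Lemma orient_left_gt0 (R : realFieldType) (T : Type) (X Y : T -> R)
    (b s c r : T) :
    X b < X s -> X s < X c -> X s < X r ->
    0 < orient X Y b c s -> 0 < orient X Y r b s ->
  0 < orient X Y c r s.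
Proof.
move=> bs sc sr h1 h2; rewrite -(@pmulr_rgt0 _ (X s - X b)) ?subr_gt0 //.
have -> : (X s - X b) * orient X Y c r s =
    (X c - X s) * orient X Y r b s + (X r - X s) * orient X Y b c s.
  by rewrite /orient; ring.
by rewrite addr_gt0 // mulr_gt0 // subr_gt0.
Qed.

(** The same linear relation, with two points to the left of [s] and one to its right. *)
Lemma orient_right_gt0 (R : realFieldType) (T : Type) (X Y : T -> R)
    (l b s r : T) :
    X l < X s -> X b < X s -> X s < X r ->
    0 < orient X Y b r s -> 0 < orient X Y r l s ->
  0 < orient X Y l b s.
Proof.
move=> ls bs sr h1 h2; rewrite -(@pmulr_rgt0 _ (X r - X s)) ?subr_gt0 //.
have -> : (X r - X s) * orient X Y l b s =
    (X s - X l) * orient X Y b r s + (X s - X b) * orient X Y r l s.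
  by rewrite /orient; ring.
by rewrite addr_gt0 // mulr_gt0 // subr_gt0.
Qed.

Section Separated.
Variables (R : realFieldType) (T : finType) (X Y : T -> R).
Hypothesis gXY : generic X Y.

Lemma lt_uniq3 (b s r : T) : X b < X s -> X s < X r -> uniq [:: r; b; s].
Proof.
move=> bs sr; have br := lt_trans bs sr.
rewrite /= !inE; case: eqVneq => [rb|_]; first by rewrite rb ltxx in br.
case: eqVneq => [rs|_]; first by rewrite rs ltxx in sr.
by case: eqVneq => [e|_] //; rewrite e ltxx in bs.
Qed.

(** Points on the line may count for either side: weak inequalities give a nonnegative orientation,
    and [generic] excludes zero. *)
Lemma orient_below (u c : R) (b s r : T) :
    X b < X s -> X s < X r ->
    c <= Y b - u * X b -> Y s - u * X s <= c -> c <= Y r - u * X r ->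
  0 < orient X Y r b s.
Proof.
move=> bs sr gb gs gr; rewrite lt_def (gXY (lt_uniq3 bs sr)) /=.
have -> : orient X Y r b s =
    (X r - X s) * ((Y b - u * X b) - (Y s - u * X s)) +
    ((Y r - u * X r) - (Y s - u * X s)) * (X s - X b).
  by rewrite /orient; ring.
by apply: addr_ge0; apply: mulr_ge0; lra.
Qed.

Lemma orient_above (u c : R) (b s r : T) :
    X b < X s -> X s < X r ->
    Y b - u * X b <= c -> c <= Y s - u * X s -> Y r - u * X r <= c ->
  0 < orient X Y b r s.
Proof.
move=> bs sr gb gs gr; have := gXY (lt_uniq3 bs sr).
have -> : orient X Y r b s = - orient X Y b r s by rewrite /orient; ring.
rewrite oppr_eq0 lt_def => -> /=.
have -> : orient X Y b r s =
    (X r - X s) * ((Y s - u * X s) - (Y b - u * X b)) +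
    ((Y s - u * X s) - (Y r - u * X r)) * (X s - X b).
  by rewrite /orient; ring.
by apply: addr_ge0; apply: mulr_ge0; lra.
Qed.

End Separated.

(** * A non-crossing family in a dense remainder *)

(** A line halving [A] and [S] at [2 * m] has more than [30 * m] points on or above it, by density.
    Fewer than [2 * m] are in [A] strictly above the line, at most two are on it and at most
    [24 * m] are in [M]; enough remain for [B]. *)
Lemma upper_line (R : realFieldType) (T : finType) (X Y : T -> R)
    (A M B S : {set T}) (m : nat) :
    generic X Y -> (0 < m)%N ->
    (forall a s, a \in A -> s \in S -> X a < X s) ->
    (forall p, [|| p \in A, p \in M | p \in B]) ->
    (#|M| <= 24 * m)%N -> (2 * m <= #|A|)%N -> (2 * m <= #|S|)%N ->
    (forall u v c, (2 * m <= #|S :&: halfplane X Y u v c|)%N ->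
       (30 * m < #|halfplane X Y u v c|)%N) ->
  exists u c : R, let g p := Y p - u * X p in
    [/\ (2 * m <= #|[set p in A | (c <= g p)%R]|)%N,
        (2 * m <= #|[set p in B | (c <= g p)%R]|)%N
      & (#|[set p in S | (c < g p)%R]| < 2 * m)%N].
Proof.
move=> gXY m0 AS cov M24 A2 S2 dense.
have t0 n : (2 * m <= n -> 0 < 2 * m <= n)%N by lia.
have [u [c /= [Alt Age Slt Sge]]] := halving_line Y AS (t0 _ A2) (t0 _ S2).
exists u, c; split=> //.
have /dense : (2 * m <= #|S :&: halfplane X Y (- u) 1%R c|)%N.
  apply: leq_trans Sge (subset_leq_card _); apply/subsetP => p.
  by rewrite !inE mul1r mulNr [- _ + _]addrC.
set H := halfplane _ _ _ _ _ => H30.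
have : (#|H| <= #|[set p in A | (c < Y p - u * X p)%R]| +
    #|[set p | (Y p - u * X p == c)%R]| + #|M| +
    #|[set p in B | (c <= Y p - u * X p)%R]|)%N.
  have cU (P Q : {set T}) n : (#|P| <= n -> #|P :|: Q| <= n + #|Q|)%N.
    by move=> h; apply: leq_trans (leq_card_setU _ _) _; rewrite leq_add2r.
  apply: leq_trans (subset_leq_card _) (cU _ _ _ (cU _ _ _ (cU _ _ _ (leqnn _)))).
  apply/subsetP => p; rewrite !inE mul1r mulNr [- _ + _]addrC => cp.
  rewrite cp andbT; have := cov p; case: (p \in A) => /=.
    by move: cp; rewrite le_eqVlt eq_sym => /orP[] ->; rewrite ?orbT.
  by case/orP => ->; rewrite ?orbT.
have := card_generic_line u c gXY.
have fin a l n b h : (h <= a + l + n + b -> l <= 2 -> a < 2 * m ->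
   n <= 24 * m -> 30 * m < h -> 2 * m <= b)%N by lia.
by move=> l2 h; apply: fin h l2 Alt M24 H30.
Qed.

Lemma card_sepP (R : realFieldType) (T : finType) (S : {set T}) (f : T -> R)
    (c : R) (n : nat) : (#|[set p in S | (c < f p)%R]| < n)%N ->
  (#|S| < n + #|[set p in S | (f p <= c)%R]|)%N.
Proof.
move=> h; rewrite -(cardsID [set p | c < f p] S).
have -> : S :&: [set p | c < f p] = [set p in S | c < f p].
  by apply/setP => p; rewrite !inE.
have -> : S :\: [set p | c < f p] = [set p in S | f p <= c].
  by apply/setP => p; rewrite !inE -leNgt andbC.
by rewrite ltn_add2r.
Qed.


(** Sort the points by abscissa and take a block of consecutive points that is rich in [U].
    Injectivity of [X] makes the separation strict. *)
Lemma dense_slab (R : realFieldType) (T : finType) (X : T -> R) (U : {set T})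
    (q : nat) :
    injective X -> (#|T| + 4 * q <= 4 * #|U|)%N ->
  exists A M B : {set T},
    [/\ forall a b, a \in A -> b \in M -> X a < X b,
        forall a b, a \in M -> b \in B -> X a < X b,
        forall p, [|| p \in A, p \in M | p \in B],
        (#|M| <= 4 * q)%N & (q <= #|U :&: M|)%N].
Proof.
move=> injX qU; pose le p r := X p <= X r; pose s := sort le (enum T).
have us : uniq s by rewrite sort_uniq enum_uniq.
have ms p : p \in s by rewrite mem_sort mem_enum.
have le_tr : transitive le by move=> y x z; apply: le_trans.
have ss : pairwise le s.
  by rewrite -sorted_pairwise // sort_sorted // => x y; apply: le_total.
have [|s1 [s2 [s3 [es s2q qs]]]] := @dense_block _ (mem U) q s.
  rewrite size_sort -cardE (permP (permEl (perm_sort _ _))).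
  by rewrite -sum1_count big_enum_cond sum1_card.
have lt_le x y : le x y -> x != y -> X x < X y.
  by rewrite lt_neqAle (inj_eq injX) => xy ->.
have card_part (s' : seq T) : uniq s' -> #|[set x in s']| = size s'.
  by rewrite cardsE => /card_uniqP.
move: us ss ms; rewrite es !cat_uniq !pairwise_cat !allrel_catr.
case/and3P => u1 n1 /and3P[u2 n2 u3].
case/and3P => /andP[h12 h13] _ /and3P[h23 _ _] ms.
exists [set x in s1], [set x in s2], [set x in s3].
split=> [a b|a b|p||]; rewrite ?inE.
- move=> a1 b2; apply: lt_le; first exact: (allrelP h12).
  apply: contraNneq n1 => ab; apply/hasP; exists b; last by rewrite -ab.
  by rewrite mem_cat b2.
- move=> a2 b3; apply: lt_le; first exact: (allrelP h23).
  by apply: contraNneq n2 => ab; apply/hasP; exists b => //; rewrite -ab.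
- by have := ms p; rewrite !mem_cat.
- by rewrite card_part.
apply: leq_trans qs _; rewrite -size_filter -card_part ?filter_uniq //.
by apply: subset_leq_card; apply/subsetP => x; rewrite !inE mem_filter.
Qed.

Lemma noncrossing_core (R : realFieldType) (T : finType) (X Y : T -> R)
    (U : {set T}) (m : nat) :
    generic X Y -> injective X -> (0 < m)%N -> (#|T| + 24 * m <= 4 * #|U|)%N ->
    (forall u v c, (2 * m <= #|U :&: halfplane X Y u v c|)%N ->
       (30 * m < #|halfplane X Y u v c|)%N) ->
  exists P0 P1 P2 P3 : {set T},
    [/\ (m <= #|P0|)%N, (m <= #|P1|)%N, (m <= #|P2|)%N & (m <= #|P3|)%N] /\
    forall p0 p1 p2 p3, p0 \in P0 -> p1 \in P1 -> p2 \in P2 -> p3 \in P3 ->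
      [/\ 0 < orient X Y p0 p1 p3, 0 < orient X Y p1 p2 p3
        & 0 < orient X Y p2 p0 p3].
Proof.
move=> gXY injX m0 cU dense.
(* From [6 * m] points of [U] in the slab, the upper and the lower line each remove fewer than
   [2 * m], so that more than [2 * m] remain for the last cut. *)
have [|A [M [B [AM MB cov M24 S6]]]] := @dense_slab _ _ _ U (6 * m) injX.
  by rewrite mulnA.
rewrite mulnA in M24; set S := U :&: M in S6.
have SM s : s \in S -> s \in M by rewrite inE => /andP[].
have denseS u v c : (2 * m <= #|S :&: halfplane X Y u v c|)%N ->
    (30 * m < #|halfplane X Y u v c|)%N.
  move=> h; apply: dense; apply: leq_trans h (subset_leq_card _).
  by apply: setSI; apply: subsetIl.
have M0 : (0 < #|M|)%N.
  by apply: leq_trans (subset_leq_card (subsetIr U M)); rewrite -/S; lia.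
(* A vertical halfplane containing [S] has more than [30 * m] points, at most [24 * m] of them in
   the slab. *)
have far (Q : {set T}) u c : S \subset halfplane X Y u 0 c ->
    halfplane X Y u 0 c \subset M :|: Q -> (2 * m <= #|Q|)%N.
  move=> SH HQ; have := @denseS u 0 c; rewrite (setIidPl SH) => h.
  have := leq_trans (subset_leq_card HQ) (leq_card_setU _ _).
  have : (30 * m < #|halfplane X Y u 0 c|)%N by apply: h; lia.
  lia.
have A2 : (2 * m <= #|A|)%N.
  have [d dM dmax] := arg_max_in X M0.
  apply: (@far _ (-1) (- X d)); apply/subsetP => p.
    by move/SM => pM; rewrite inE; have := dmax p pM; lra.
  rewrite !inE => h; have /or3P[-> |-> |pB] := cov p; rewrite ?orbT //.
  by have := MB _ _ dM pB; lra.
have B2 : (2 * m <= #|B|)%N.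
  have [d dM dmax] := arg_max_in (fun p => - X p) M0.
  apply: (@far _ 1 (X d)); apply/subsetP => p.
    by move/SM => pM; rewrite inE; have := dmax p pM; lra.
  rewrite !inE => h; have /or3P[pA|-> |->] := cov p; rewrite ?orbT //.
  by have := AM _ _ pA dM; lra.
have AS a s : a \in A -> s \in S -> X a < X s by move=> aA /SM; apply: AM.
have SB s b : s \in S -> b \in B -> X s < X b by move=> /SM; apply: MB.
have S2 : (2 * m <= #|S|)%N by lia.
have [u1 [c1 /= [L1c R1c S1c]]] :=
  upper_line gXY m0 AS cov M24 A2 S2 denseS.
have gN : generic X (fun p => - Y p).
  move=> a b c /gXY; apply: contraNneq => h.
  by rewrite -[_ == 0]oppr_eq0 -h /orient; apply/eqP; ring.
(* The lower line is the upper line of the points reflected in the horizontal axis. *)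
have [u2 [c2 /= [L2c R2c S2c]]] : exists u c : R,
    [/\ (2 * m <= #|[set p in A | (Y p - u * X p <= c)%R]|)%N,
        (2 * m <= #|[set p in B | (Y p - u * X p <= c)%R]|)%N
      & (#|[set p in S | (- c < - (Y p - u * X p))%R]| < 2 * m)%N].
  have [|u [c /= [h1 h2 h3]]] := upper_line gN m0 AS cov M24 A2 S2.
    move=> u v c.
    have -> : halfplane X (fun p => - Y p) u v c = halfplane X Y u (- v) c.
      by apply/setP => p; rewrite !inE mulrN mulNr.
    exact: denseS.
  have e p : - Y p - u * X p = - (Y p - - u * X p) by ring.
  exists (- u), (- c); split.
  - apply: leq_trans h1 (subset_leq_card _); apply/subsetP => p.
    by rewrite !inE e => /andP[->]; rewrite lerNr.
  - apply: leq_trans h2 (subset_leq_card _); apply/subsetP => p.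
    by rewrite !inE e => /andP[->]; rewrite lerNr.
  - apply: leq_ltn_trans (subset_leq_card _) h3; apply/subsetP => p.
    by rewrite !inE e opprK.
have /card_sepP := S1c; set S1 := [set p in S | _] => S1c'.
have : (#|[set p in S1 | (- c2 < - (Y p - u2 * X p))%R]| < 2 * m)%N.
  apply: leq_ltn_trans (subset_leq_card _) S2c; apply/subsetP => p.
  by rewrite !inE => /andP[/andP[-> _] ->].
move/card_sepP; set S' := [set p in S1 | _] => S2c'.
(* [L1], [R1] lie above [S'], and [L2], [R2] below it. *)
set L1 := [set p in A | _] in L1c; set R1 := [set p in B | _] in R1c.
set L2 := [set p in A | _] in L2c; set R2 := [set p in B | _] in R2c.
have inL1 p : p \in L1 -> p \in A /\ c1 <= Y p - u1 * X p.
  by rewrite inE => /andP.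
have inR1 p : p \in R1 -> p \in B /\ c1 <= Y p - u1 * X p.
  by rewrite inE => /andP.
have inL2 p : p \in L2 -> p \in A /\ Y p - u2 * X p <= c2.
  by rewrite inE => /andP.
have inR2 p : p \in R2 -> p \in B /\ Y p - u2 * X p <= c2.
  by rewrite inE => /andP.
have inS' p : p \in S' ->
    [/\ p \in S, Y p - u1 * X p <= c1 & c2 <= Y p - u2 * X p].
  by rewrite inE => /andP[]; rewrite inE lerN2 => /andP[].
have LS' a s : a \in L2 -> s \in S' -> X a < X s.
  by move=> /inL2[aA _] /inS'[sS _ _]; apply: AS.
have [||u [c /= [bgt bge sgt sge]]] := @halving_line _ _ X Y L2 S' m m LS'.
- by rewrite m0 /=; lia.
- by rewrite m0 /=; lia.
have setP2 (Q : {set T}) (P : pred T) p : p \in [set x in Q | P x] ->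
    p \in Q /\ P p by rewrite inE => /andP.
have half n b : (2 * m <= n -> n < m + b -> m <= b)%N by lia.
(* If few points of [R1] are strictly above the last line, then [s] lies above the segments from the
   lower part of [L2] to the lower part of [R1], by the last line, and below those from [L1] to
   [R1], by the upper line. *)
have [r_lt|r_ge] := ltnP #|[set p in R1 | (c < Y p - u * X p)%R]| m.
  exists L1, [set p in L2 | Y p - u * X p <= c],
    [set p in R1 | Y p - u * X p <= c], [set p in S' | c <= Y p - u * X p].
  have := card_sepP bgt; have := card_sepP r_lt => cr cl.
  split.
    split=> //; first by apply: leq_trans L1c; lia.
    - exact: half L2c cl.
    - exact: half R1c cr.
  move=> l b r s /inL1[lA gl] /setP2[/inL2[bA _] gb].
  move=> /setP2[/inR1[rB gr1] gr] /setP2[/inS'[sS gs1 _] gs].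
  have bs := AS _ _ bA sS; have sr := SB _ _ sS rB; have ls := AS _ _ lA sS.
  have h1 := orient_above gXY bs sr gb gs gr.
  have h2 := orient_below gXY ls sr gl gs1 gr1.
  by split=> //; apply: orient_right_gt0 h1 h2.
(* Now [s] lies below the segments from the upper part of [L2] to the upper part of [R1], by the
   last line, and above those from [L2] to [R2], by the lower line. *)
exists [set p in L2 | c <= Y p - u * X p], R2,
  [set p in R1 | c <= Y p - u * X p], [set p in S' | Y p - u * X p <= c].
have cs := card_sepP sgt.
split.
  split=> //; first by apply: leq_trans R2c; lia.
  - apply: leq_trans r_ge (subset_leq_card _); apply/subsetP => p.
    by rewrite !inE => /andP[-> /ltW].
  - by apply: half cs; lia.
move=> b c' r s /setP2[/inL2[bA gb2] gb] /inR2[cB gc2].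
move=> /setP2[/inR1[rB _] gr] /setP2[/inS'[sS _ gs2] gs].
have bs := AS _ _ bA sS; have sr := SB _ _ sS rB; have sc := SB _ _ sS cB.
have h1 := orient_above gXY bs sc gb2 gs2 gc2.
have h2 := orient_below gXY bs sr gb gs gr.
by split=> //; apply: orient_left_gt0 h1 h2.
Qed.


(** * Selecting a convex bundle, and the dichotomy *)

Lemma sum_card_setI_disjoint (T I : finType) (H : {set T}) (C : I -> {set T}) :
    (forall i j, i != j -> [disjoint C i & C j]) ->
  (\sum_i #|H :&: C i| <= #|H|)%N.
Proof.
move=> dC; under eq_bigr do rewrite -sum1_card big_mkcond.
rewrite exchange_big -sum1_card [leqRHS]big_mkcond /=; apply: leq_sum => p _.
case: ifP => pH; last by rewrite big1 // => i _; rewrite inE pH.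
have [[i pi]|np] := pselect (exists i, p \in C i).
  rewrite (bigD1 i) //= inE pH pi big1 ?addn0 // => j ji.
  by rewrite inE pH (disjointFl (dC _ _ ji)).
by rewrite big1 // => i _; rewrite inE pH /=; case: ifP => // h; case: np; exists i.
Qed.

(* [182 = 6 * 30 + 2] comes from [sparse_subset]. *)
Lemma exposed_selection (T : finType) (m k K : nat) (H C : 'I_K -> {set T}) :
    (0 < m)%N -> (k * 182 <= K)%N ->
    (forall i, #|H i| <= 30 * m)%N -> (forall i, C i \subset H i) ->
    (forall i, #|C i| = 2 * m)%N ->
    (forall i j, i != j -> [disjoint C i & C j]) ->
  exists (f : 'I_k -> 'I_K) (B : 'I_k -> {set T}),
    [/\ forall i, #|B i| = m, forall i, B i \subset H (f i),
        forall i j, i != j -> [disjoint B j & H (f i)]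
      & forall i j, i != j -> [disjoint B i & B j]].
Proof.
(* The weight counts the points of [C j] lost to [H i]; as the [C j] are disjoint, each row sums to
   at most [#|H i|]. *)
move=> m0 kK H30 CH C2 dC; pose w i j := #|H i :&: C j|.
have [i||I [kI wI]] := @sparse_subset _ w m 30 k m0.
- by apply: leq_trans (H30 i); apply: sum_card_setI_disjoint.
- by rewrite card_ord.
(* The weight into [v] is at most [m], so [m] of the [2 * m] points of [C v] avoid the other
   selected sets [H i]. *)
pose D v := C v :\: \bigcup_(i in I | i != v) H i.
have cD v : v \in I -> (m <= #|D v|)%N.
  move=> vI; have := cardsID (\bigcup_(i in I | i != v) H i) (C v).
  have : (#|C v :&: \bigcup_(i in I | i != v) H i| <= m)%N.
    apply: leq_trans (wI v vI); rewrite /w.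
    elim/big_rec2: _ => [|i n X _ hX]; first by rewrite setI0 cards0.
    rewrite setIUr; apply: leq_trans (leq_card_setU _ _) _.
    by rewrite setIC leq_add2l.
  rewrite C2 -/(D v); lia.
pose f (i : 'I_k) := enum_val (widen_ord kI i).
have fI i : f i \in I by apply: enum_valP.
have fne i j : i != j -> f i != f j.
  apply: contra_neq => /enum_val_inj /(congr1 val) /= ij; exact: val_inj.
have /choice[B hB] i : exists B : {set T}, B \subset D (f i) /\ #|B| = m.
  by have [B BD cB] := subset_of_card (cD _ (fI i)); exists B.
have BC i : B i \subset C (f i).
  by case: (hB i) => h _; apply: subset_trans h (subsetDl _ _).
exists f, B; split=> [i|i|i j ij|i j ij].
- by case: (hB i).
- exact: subset_trans (BC i) (CH _).
- rewrite disjoints_subset; case: (hB j) => h _; apply: subset_trans h _.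
  rewrite /D setDE; apply: subset_trans (subsetIr _ _) _; rewrite setCS.
  by apply: (bigcup_sup (f i)); rewrite fI fne.
- rewrite disjoints_subset; apply: subset_trans (BC i) _.
  apply: subset_trans (_ : ~: C (f j) \subset _); last by rewrite setCS.
  by rewrite -disjoints_subset dC // fne.
Qed.

(** Each [c i] is the strict maximum of a linear functional over the family; in particular the
    points are distinct. *)
Definition exposing (R : realFieldType) (T I : Type) (X Y : T -> R)
    (c : I -> T) :=
  forall i, exists u v : R, forall j, i <> j ->
    u * X (c j) + v * Y (c j) < u * X (c i) + v * Y (c i).

Lemma exposed_or_noncrossing_inj (R : realFieldType) (T : finType)
    (X Y : T -> R) (m k : nat) :
    generic X Y -> injective X -> (0 < m)%N -> (0 < k)%N ->
    (1000 * k * m <= #|T|)%N ->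
  (exists B : 'I_k -> {set T},
     [/\ forall i, #|B i| = m, forall i j, i != j -> [disjoint B i & B j]
       & forall c, (forall i, c i \in B i) -> exposing X Y c]) \/
  (exists P0 P1 P2 P3 : {set T},
    [/\ (m <= #|P0|)%N, (m <= #|P1|)%N, (m <= #|P2|)%N & (m <= #|P3|)%N] /\
    forall p0 p1 p2 p3, p0 \in P0 -> p1 \in P1 -> p2 \in P2 -> p3 \in P3 ->
      [/\ 0 < orient X Y p0 p1 p3, 0 < orient X Y p1 p2 p3
        & 0 < orient X Y p2 p0 p3]).
Proof.
move=> gXY injX m0 k0 cT.
pose h (H : {set T}) :=
  (exists u v c, H = halfplane X Y u v c) /\ (#|H| <= 30 * m)%N.
have [[H [C [hH CH C2 dC]]]|[U [cU hU]]] :=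
    disjoint_subsets_or_remainder h (2 * m) (k * 182).
  left; have [f [B [cB BH Bout dB]]] :=
    exposed_selection m0 (leqnn _) (fun i => (hH i).2) CH C2 dC.
  exists B; split=> // c cB' i; have [[u [v [d Hd]]] _] := hH (f i).
  (* The normal of the halfplane that contains [c i] serves, since the other chosen points lie
     outside this halfplane. *)
  exists u, v => j /eqP ij.
  have := subsetP (BH i) _ (cB' i); rewrite Hd inE; apply: lt_le_trans.
  have /negbT := disjointFr (Bout _ _ ij) (cB' j).
  by rewrite Hd inE -ltNge.
(* The greedy removal costs at most [364 * k * m] points, so [1000 * k * m] points leave a [U] with
   [#|T| + 24 * m <= 4 * #|U|]. *)
right; apply: (@noncrossing_core _ _ X Y U) => //; first by nia.
move=> u v c; rewrite leqNgt => /negP cU'; rewrite ltnNge; apply/negP => cH.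
by apply/cU'/hU; split=> //; exists u, v, c.
Qed.

(** Two points with distinct ordinates collide for a single [z], whose absolute value is a term of
    the sum; [1 + \sum_r F r] exceeds every term. Pairs with equal ordinates contribute 0, as
    division by zero yields 0. *)
Lemma shear_injective (R : realFieldType) (T : finType) (X Y : T -> R) :
    (forall p q, X p = X q -> Y p = Y q -> p = q) ->
  exists z : R, injective (fun p => X p + z * Y p).
Proof.
move=> inj; pose F (r : T * T) := `|(X r.1 - X r.2) / (Y r.1 - Y r.2)|.
exists (1 + \sum_r F r) => p q /= epq.
have [Ypq|Ypq] := eqVneq (Y p) (Y q).
  by apply: inj => //; move: epq; rewrite Ypq => /addIr.
have Y0 : Y p - Y q != 0 by rewrite subr_eq0.
have e : 1 + \sum_r F r = - ((X p - X q) / (Y p - Y q)).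
  apply: (mulIf Y0); rewrite -mulNr divfK //; lra.
have F0 r : 0 <= F r by apply: normr_ge0.
have : F (p, q) <= \sum_r F r by rewrite (bigD1 (p, q)) //= lerDl sumr_ge0.
have -> : F (p, q) = 1 + \sum_r F r.
  rewrite -[RHS]ger0_norm; first by rewrite e normrN.
  by rewrite addr_ge0 // sumr_ge0.
by rewrite gerDr ler10.
Qed.

(** A shear makes the abscissas distinct, preserves orientations and pulls linear functionals back
    to linear functionals. *)
Lemma exposed_or_noncrossing (R : realFieldType) (T : finType)
    (X Y : T -> R) (m k : nat) :
    (forall p q, X p = X q -> Y p = Y q -> p = q) ->
    generic X Y -> (0 < m)%N -> (0 < k)%N -> (1000 * k * m <= #|T|)%N ->
  (exists B : 'I_k -> {set T},
     [/\ forall i, #|B i| = m, forall i j, i != j -> [disjoint B i & B j]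
       & forall c, (forall i, c i \in B i) -> exposing X Y c]) \/
  (exists P0 P1 P2 P3 : {set T},
    [/\ (m <= #|P0|)%N, (m <= #|P1|)%N, (m <= #|P2|)%N & (m <= #|P3|)%N] /\
    forall p0 p1 p2 p3, p0 \in P0 -> p1 \in P1 -> p2 \in P2 -> p3 \in P3 ->
      [/\ 0 < orient X Y p0 p1 p3, 0 < orient X Y p1 p2 p3
        & 0 < orient X Y p2 p0 p3]).
Proof.
move=> inj gXY m0 k0 cT; have [z injX] := shear_injective inj.
have oE a b c : orient (fun p => X p + z * Y p) Y a b c = orient X Y a b c.
  by rewrite /orient; ring.
have gX : generic (fun p => X p + z * Y p) Y.
  by move=> a b c /gXY; rewrite oE.
have [[B [cB dB eB]]|[P0 [P1 [P2 [P3 [cP oP]]]]]] :=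
    exposed_or_noncrossing_inj gX injX m0 k0 cT; [left|right].
  exists B; split=> // c cB' i; have [u [v uv]] := eB c cB' i.
  exists u, (u * z + v) => j /uv.
  by rewrite !mulrDr !mulrDl !addrA !mulrA.
exists P0, P1, P2, P3; split=> // p0 p1 p2 p3 h0 h1 h2 h3.
by have := oP _ _ _ _ h0 h1 h2 h3; rewrite !oE.
Qed.

From mathcomp Require Import finmap.
From mathcomp Require Import all_classical all_reals all_analysis.
Import numFieldNormedType.Exports.
Local Open Scope ring_scope.


(** * Convex hulls, extreme points and triangles in the real plane *)

Section PlaneGeometry.
Variable R : realType.
Implicit Types (A S : set (plane R)) (p q x y z : plane R).
Local Open Scope classical_set_scope.

Definition xcoord (p : plane R) : R := p 0 0.
Definition ycoord (p : plane R) : R := p 0 1.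

Lemma plane_eq p q : xcoord p = xcoord q -> ycoord p = ycoord q -> p = q.
Proof.
move=> hx hy; apply/rowP => -[[|[|//]] i2].
  by rewrite (_ : Ordinal i2 = 0) //; apply: val_inj.
by rewrite (_ : Ordinal i2 = 1) //; apply: val_inj.
Qed.

Lemma convex_segmentP A :
  convex_set (A : set (convex_lmodType (plane R))) <->
  forall x y (t : R), A x -> A y -> 0 < t < 1 -> A (t *: x + (1 - t) *: y).
Proof.
split=> [cA x y t Ax Ay /andP[t0 t1]|cA].
  pose l : {i01 R} := Itv01 (ltW t0) (ltW t1).
  have := cA x y l; rewrite !inE => /(_ Ax Ay).
  by rewrite /conv /=.
apply/convex_setW => x y; rewrite !inE => Ax Ay l l0 l1.
by rewrite inE; apply: cA => //; rewrite l0 l1.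
Qed.

Lemma sub_convex_hull S : S `<=` convex_hull S.
Proof. by move=> x Sx B [_]; apply. Qed.

Lemma convex_hull_sub S A :
    S `<=` A ->
    (forall x y (t : R), A x -> A y -> 0 < t < 1 -> A (t *: x + (1 - t) *: y)) ->
  convex_hull S `<=` A.
Proof. by move=> SA /convex_segmentP cA x; apply. Qed.

Lemma convex_hull_segment S x y (t : R) : convex_hull S x -> convex_hull S y ->
  0 < t < 1 -> convex_hull S (t *: x + (1 - t) *: y).
Proof.
move=> Sx Sy t01 A [cA SA]; have /convex_segmentP := cA; apply=> //.
  by apply: Sx.
by apply: Sy.
Qed.

Lemma exposed_convex_position (k : nat) (c : 'I_k -> plane R) :
  exposing xcoord ycoord c -> convex_position (range c).
Proof.
move=> ec; exists (convex_hull (range c)); first by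
  exists (range c) => //; apply: finite_image; apply: finite_finset.
have hullc := @sub_convex_hull (range c).
apply/seteqP; split=> [x [Qx xtr]|_ [i _ <-]].
  (* An extreme point outside [range c] could be deleted from the hull, leaving a smaller convex set
     that contains [range c]. *)
  apply: contrapT => ncx.
  suff /(_ x Qx)[_] : convex_hull (range c) `<=` convex_hull (range c) `\ x.
    by apply.
  apply: convex_hull_sub => [y cy|y z t [Qy yx] [Qz zx] t01]; split.
  - exact: hullc.
  - by move=> /= yx; apply: ncx; rewrite -yx.
  - exact: convex_hull_segment.
  - by move=> /= /esym /(xtr _ _ _ Qy Qz t01) [/yx].
split; first by apply: hullc; exists i.
have [u [v uv]] := ec i; pose f p := u * xcoord p + v * ycoord p.
have fD p q t : f (t *: p + (1 - t) *: q) = t * f p + (1 - t) * f q.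
  by rewrite /f /xcoord /ycoord !mxE; ring.
(* Adding [c i] to the set where [f] is smaller keeps it convex, so [c i] is the only maximum of [f]
   on the hull. *)
have hf : convex_hull (range c) `<=` [set p | p = c i \/ f p < f (c i)].
  apply: convex_hull_sub => [_ [j _ <-] /=|p q t /= hp hq /andP[t0 t1]].
    by have [->|/eqP ij] := eqVneq i j; [left|right; apply: uv].
  case: hp => [->|hp]; case: hq => [->|hq]; last 3 first.
  - by right; rewrite fD; nra.
  - by right; rewrite fD; nra.
  - by right; rewrite fD; nra.
  by left; rewrite -scalerDl addrC subrK scale1r.
move=> y z t Qy Qz /andP[t0 t1] e; have := congr1 f e; rewrite fD.
case: (hf _ Qy) (hf _ Qz) => [->|fy] [->|fz] // fe; exfalso; nra.
Qed.

(** The three strict orientations define an open set around [s], each point of which is a convex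
    combination of [a], [b], [c] with weights proportional to the areas opposite to them. *)
Lemma triangle_interior (a b c s : plane R) :
    0 < orient xcoord ycoord a b s -> 0 < orient xcoord ycoord b c s ->
    0 < orient xcoord ycoord c a s ->
  interior (convex_hull [set a; b; c]) s.
Proof.
move=> abs bcs cas.
pose N := [set q | 0 < orient xcoord ycoord a b q] `&`
  ([set q | 0 < orient xcoord ycoord b c q] `&`
   [set q | 0 < orient xcoord ycoord c a q]).
have oN (d e : plane R) : open [set q | 0 < orient xcoord ycoord d e q].
  have cont : continuous (fun q : plane R => orient xcoord ycoord d e q).
    move=> q; rewrite /orient /xcoord /ycoord.
    have coord i j : {for q, continuous (fun q : plane R => q i j)}.
      exact: coord_continuous.
    have cst (r : R) : {for q, continuous (fun q : plane R => r)}.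
      exact: cst_continuous.
    have factor (r t : R) i :
        {for q, continuous (fun q : plane R => r * (q 0 i - t))}.
      by apply: continuousM => //; apply: continuousB => //; apply: coord.
    by apply: (@continuousB _ _ _ (fun q : plane R => _ * (q 0 1 - _))).
  have -> : [set q | 0 < orient xcoord ycoord d e q] =
      orient xcoord ycoord d e @^-1` [set x : R | 0 < x] by [].
  by apply: open_comp => [q _|]; [exact: cont|exact: open_gt].
suff NH : N `<=` convex_hull [set a; b; c].
  apply: (filterS NH); apply: open_nbhs_nbhs; split=> //.
  by apply: openI => //; apply: openI.
move=> q [/= h1 [h2 h3]].
set o1 := orient _ _ a b q in h1; set o2 := orient _ _ b c q in h2.
set o3 := orient _ _ c a q in h3; pose w := o1 + o2 + o3.
have w0 : 0 < w by rewrite /w; lra.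
have o13 : 0 < o1 + o3 by lra.
have nw : w != 0 by rewrite gt_eqF.
have n13 : o1 + o3 != 0 by rewrite gt_eqF.
have sub := @sub_convex_hull [set a; b; c].
(* The barycentric coordinates [o2 / w], [o3 / w], [o1 / w], nested so that [convex_hull_segment]
   applies twice. *)
have -> : q = (o2 / w) *: a +
    (1 - o2 / w) *: ((o3 / (o1 + o3)) *: b + (1 - o3 / (o1 + o3)) *: c).
  have bary (f : plane R -> R) : w * f q = o2 * f a + o3 * f b + o1 * f c ->
     (forall x y (r t : R), f (r *: x + t *: y) = r * f x + t * f y) ->
     f q = f ((o2 / w) *: a +
    (1 - o2 / w) *: ((o3 / (o1 + o3)) *: b + (1 - o3 / (o1 + o3)) *: c)).
    move=> e lin; rewrite !lin; apply: (mulfI nw); rewrite e /w.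
    by field; rewrite n13 -/w nw.
  apply: plane_eq; apply: bary => [|x y r t].
  - by rewrite /w /o1 /o2 /o3 /orient; ring.
  - by rewrite /xcoord !mxE.
  - by rewrite /w /o1 /o2 /o3 /orient; ring.
  - by rewrite /ycoord !mxE.
apply: convex_hull_segment.
- by apply: sub; left; left.
- apply: convex_hull_segment; [by apply: sub; left; right|by apply: sub; right|].
  by rewrite divr_gt0 //= ltr_pdivrMr // mul1r; lra.
- by rewrite divr_gt0 //= ltr_pdivrMr // mul1r /w; lra.
Qed.

Lemma general_position_generic (P : {fset plane R}) : general_position P ->
  generic (fun p : P => xcoord (val p)) (fun p : P => ycoord (val p)).
Proof.
move=> gP a b c uabc; apply/eqP => o0.
have ab : val a != val b.
  by move: uabc; rewrite /= !inE negb_or -val_eqE => /andP[/andP[]].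
have v0 : val b - val a != 0 by rewrite subr_eq0 eq_sym.
apply: (gP (val a) _ v0); exists (val a), (val b), (val c); split.
  by split; apply: valP.
split; first by rewrite -(map_inj_uniq val_inj) in uabc.
split.
- by exists 0 => //; rewrite scale0r addr0.
- by exists 1 => //; rewrite scale1r addrC subrK.
move: o0; rewrite /orient; set A := val a; set B := val b; set C := val c => o0.
(* The parameter of [C] on the line is a ratio of ordinates if the line is vertical, of abscissas
   otherwise. *)
have [xAB|xAB] := eqVneq (xcoord B) (xcoord A).
  have yAB : ycoord B - ycoord A != 0.
    by apply: contraNneq ab => /eqP; rewrite subr_eq0 => /eqP yAB; apply/eqP/plane_eq.
  have xCA : xcoord C = xcoord A.
    apply/eqP; rewrite -subr_eq0; move/eqP: o0.
    by rewrite xAB subrr mul0r sub0r oppr_eq0 mulf_eq0 (negbTE yAB).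
  exists ((ycoord C - ycoord A) / (ycoord B - ycoord A)) => //.
  apply: plane_eq; rewrite /xcoord /ycoord !mxE -!/(xcoord _) -!/(ycoord _).
    by rewrite xAB xCA subrr mulr0 addr0.
  by rewrite divfK // addrC subrK.
have x0 : xcoord B - xcoord A != 0 by rewrite subr_eq0.
exists ((xcoord C - xcoord A) / (xcoord B - xcoord A)) => //.
apply: plane_eq; rewrite /xcoord /ycoord !mxE -!/(xcoord _) -!/(ycoord _).
  by rewrite divfK // addrC subrK.
apply: (mulfI x0); rewrite mulrDr mulrCA mulrA divfK //; lra.
Qed.

End PlaneGeometry.


(** * Transfer to finite point sets in the plane *)

Lemma orient_gt0_neq (R : realFieldType) (T : eqType) (X Y : T -> R)
    (a b c : T) :
  0 < orient X Y a b c -> [/\ a != b, b != c & a != c].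
Proof.
move=> abc; split; apply: contraTneq abc => ->; rewrite -leNgt /orient.
- by rewrite !subrr !mul0r subrr.
- by rewrite mulrC subrr.
- by rewrite !subrr !mulr0 subrr.
Qed.

Lemma ord4P (Q : 'I_4 -> Prop) : Q 0 -> Q 1 -> Q 2 -> Q 3 -> forall i, Q i.
Proof.
move=> q0 q1 q2 q3 [[|[|[|[|//]]]] i4].
- by rewrite (_ : Ordinal i4 = 0) //; apply: val_inj.
- by rewrite (_ : Ordinal i4 = 1) //; apply: val_inj.
- by rewrite (_ : Ordinal i4 = 2) //; apply: val_inj.
- by rewrite (_ : Ordinal i4 = 3) //; apply: val_inj.
Qed.

Lemma injective_ord4 (T : eqType) (p : 'I_4 -> T) :
  uniq [:: p 0; p 1; p 2; p 3] -> injective p.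
Proof.
move=> up; have nthE (i : 'I_4) : nth (p 0) [:: p 0; p 1; p 2; p 3] i = p i.
  by move: i; apply: ord4P.
move=> i j pij; apply: val_inj; apply: (uniqP (p 0) up); rewrite ?inE ?ltn_ord //.
by rewrite !nthE.
Qed.

Section Points.
Variables (R : realType) (P : {fset plane R}).
Local Open Scope fset_scope.

(** The combinatorial argument runs in the finite type of the points of [P]; this carries its sets
    back to the plane. *)
Definition points (A : {set P}) : {fset plane R} := [fset val x | x in A].

Lemma pointsP (A : {set P}) (p : plane R) :
  reflect (exists2 x, x \in A & p = val x) (p \in points A).
Proof. exact: imfsetP. Qed.

Lemma card_points (A : {set P}) : #|` points A| = #|A|.
Proof. by rewrite card_imfset //=; [rewrite -cardE|exact: val_inj]. Qed.

Lemma points_disjoint_subsets (n m : nat) (F : 'I_n -> {set P}) :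
    (0 < m)%N -> (forall i, #|F i| = m) ->
    (forall i j x, i != j -> x \in F i -> x \in F j -> False) ->
  disjoint_subsets P (points \o F).
Proof.
move=> m0 cF dF; split=> [i|i|i j ij] /=.
- by apply/fsubsetP => _ /pointsP[x _ ->]; apply: valP.
- by rewrite -cardfs_gt0 card_points cF.
- apply/fdisjointP => _ /pointsP[x xi ->]; apply/negP => /pointsP[y yj /val_inj xy].
  by apply: (dF i j x) => //; rewrite xy.
Qed.

Lemma points_min_card (n m : nat) (F : 'I_n -> {set P}) :
  (0 < n)%N -> (forall i, #|F i| = m) -> min_card (points \o F) m.
Proof.
move=> n0 cF; split; first by exists (Ordinal n0); rewrite /= card_points.
by move=> i; rewrite /= card_points cF.
Qed.

Lemma points_choice (n : nat) (F : 'I_n -> {set P}) (c : 'I_n -> plane R) :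
    (forall i, c i \in points (F i)) ->
  exists2 d : 'I_n -> P, forall i, d i \in F i & c = val \o d.
Proof.
move=> cF; have /choice[d hd] i : exists x, x \in F i /\ c i = val x.
  by have /pointsP[x] := cF i; exists x.
by exists d => [i|]; [case: (hd i)|apply/funext => i; case: (hd i)].
Qed.

End Points.

Theorem theorem2 (R : realType) :
  exists2 C : R, 0 < C &
    forall m k : nat, (0 < m)%N -> (0 < k)%N ->
    forall P : {fset plane R}, general_position P ->
      C * k%:R * m%:R <= (#|` P|)%:R ->
      (exists2 B : 'I_k -> {fset plane R},
         convex_bundle P B & min_card B m) \/
      (exists2 F : 'I_4 -> {fset plane R},
         noncrossing_family P F & min_card F m).
Proof.
exists 1000%:R; first by rewrite ltr0n.
move=> m k m0 k0 P gP; rewrite -!natrM ler_nat => cP.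
have gXY := general_position_generic gP.
have inj (p q : P) : xcoord (val p) = xcoord (val q) ->
    ycoord (val p) = ycoord (val q) -> p = q.
  by move=> hx hy; apply: val_inj; apply: plane_eq.
have cT : (1000 * k * m <= #|{: P}|)%N by rewrite -cardfE.
have [[B [cB dB eB]]|[P0 [P1 [P2 [P3 [[c0 c1 c2 c3] oP]]]]]] :=
    exposed_or_noncrossing inj gXY m0 k0 cT; [left|right].
  exists (@points _ P \o B); last exact: points_min_card.
  split.
    apply: (points_disjoint_subsets m0 cB) => i j x ij xi.
    by rewrite (disjointFr (dB _ _ ij) xi).
  move=> c /points_choice[d dB' ->]; apply: exposed_convex_position => i.
  exact: eB.
(* [min_card] asks for a minimum of exactly [m], so the four sets are cut down to [m] points. *)
have [Q0 Q0P cQ0] := subset_of_card c0; have [Q1 Q1P cQ1] := subset_of_card c1.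
have [Q2 Q2P cQ2] := subset_of_card c2; have [Q3 Q3P cQ3] := subset_of_card c3.
pose F (i : 'I_4) := nth Q0 [:: Q0; Q1; Q2; Q3] i.
have cF i : #|F i| = m by move: i; apply: ord4P.
have oF (p : 'I_4 -> P) : (forall i, p i \in F i) ->
    let o a b c := orient (fun p : P => xcoord (val p))
                          (fun p : P => ycoord (val p)) a b c in
    [/\ 0 < o (p 0) (p 1) (p 3), 0 < o (p 1) (p 2) (p 3)
      & 0 < o (p 2) (p 0) (p 3)].
  move=> pF; apply: oP; [apply: (fintype.subsetP Q0P) | apply: (fintype.subsetP Q1P)
    | apply: (fintype.subsetP Q2P) | apply: (fintype.subsetP Q3P)]; first exact: (pF 0).
  - exact: (pF 1).
  - exact: (pF 2).
  - exact: (pF 3).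
exists (@points _ P \o F); last exact: points_min_card.
split.
  (* Disjointness follows from the orientations: a common point of two sets could be chosen from
     both, while positive orientations make the four chosen points distinct. *)
  apply: (points_disjoint_subsets m0 cF) => i j x ij xi xj.
  have /choice[d dF] l : exists y, y \in F l.
    by apply/card_gt0P; rewrite cF.
  pose p l := if (l == i) || (l == j) then x else d l.
  have pF l : p l \in F l.
    by rewrite /p; case: eqP => [->|_] //=; case: eqP => [->|_] /=.
  have [/orient_gt0_neq[n01 n13 n03] /orient_gt0_neq[n12 n23 _]] := oF p pF.
  move=> /orient_gt0_neq[n20 _ _].
  have pij : p i = p j by rewrite /p !eqxx orbT.
  have /injective_ord4/(_ _ _ pij) ij' : uniq [:: p 0; p 1; p 2; p 3].
    rewrite /= !inE !negb_or n01 (eq_sym (p 0) (p 2)) n20 n03.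
    by rewrite n12 n13 n23.
  by rewrite ij' eqxx in ij.
move=> p /points_choice[d dF ->] /=.
by have [] := oF d dF; apply: triangle_interior.
Qed.
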